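(* Let $x,y\in X$ satisfy $1<\partial(x,y)<k$ and write $i=\partial(x,y)$. Then $$\widehat{x\cap y}=\frac{-1}{q^{k+i}[n-2k]}\,\check{B}_{xy}+\frac{-[k-i]}{q^k[i-1][n-2k]}\,\check{C}_{xy},$$ $$\widehat{x+y}=\frac{1}{q^k[n-2k]}\,\check{B}_{xy}+\frac{[n-k-i]}{q^{k-i}[i-1][n-2k]}\,\check{C}_{xy}.$$
   Context: Let $\mathbb{F}_q$ be a finite field with $q$ elements, let $n,k$ be integers with $n>2k\geq 6$, and let $V$ be an $n$-dimensional vector space over $\mathbb{F}_q$. For $m\in\mathbb{Z}$ write $[m]=(q^m-1)/(q-1)$. Let $P$ be the set of all subspaces of $V$ and $P_\ell$ the set of $\ell$-dimensional subspaces; put $X=P_k$. The Grassmann graph $\Gamma=J_q(n,k)$ has vertex set $X$, with $x,y\in X$ adjacent iff $\dim(x\cap y)=k-1$; $\partial$ is its path-length distance and $\Gamma(x)$ is the set of neighbours of $x$. Let $E$ be a (real) Euclidean space of dimension $[n]-1$ with inner product $\langle\,,\,\rangle$, and let $P_1\to E$, $s\mapsto\widehat{s}$ be a map such that: $E=\mathrm{Span}\{\widehat{s}\mid s\in P_1\}$; $\|\widehat{s}\|^2=[n]-1$ for $s\in P_1$; $\langle\widehat{s},\widehat{t}\rangle=-1$ for distinct $s,t\in P_1$; and $\sum_{s\in P_1}\widehat{s}=0$. For $u\in P$ define $\widehat{u}=\sum_{s\in P_1,\,s\subseteq u}\widehat{s}$. For $x,y\in X$ with $i=\partial(x,y)$,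 $1<i<k$, define $\mathcal{B}_{xy}=\{z\in\Gamma(x)\mid\partial(y,z)=i+1\}$, $\mathcal{C}_{xy}=\{z\in\Gamma(x)\mid\partial(y,z)=i-1\}$, $B_{xy}=\sum_{z\in\mathcal{B}_{xy}}\widehat{z}$, $C_{xy}=\sum_{z\in\mathcal{C}_{xy}}\widehat{z}$, $$\overline{B_{xy}}=B_{xy}-q^{2i}[k-i][n-k-i]\,\widehat{x},\qquad \overline{C_{xy}}=C_{xy}-q[i][i-2]\,\widehat{x},$$ and $$\check{B}_{xy}=\overline{B_{xy}},\qquad \check{C}_{xy}=\overline{C_{xy}}-q^{i-1}\bigl(\widehat{x}+\widehat{y}\bigr).$$ *)

(* Defs.v *)
From HB Require Import structures.
From mathcomp Require Import all_boot all_order all_algebra.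
From mathcomp Require Import reals.

Set Implicit Arguments.
Unset Strict Implicit.
Unset Printing Implicit Defensive.
Import Order.TTheory GRing.Theory Num.Theory.
Import VectorInternalTheory.
Local Open Scope ring_scope.

(* The subtype structure of {vspace V} over matrices, needed for these two
   instances, is only available from VectorInternalTheory. *)
HB.instance Definition _ (F : finFieldType) (V : vectType F) :=
  [Countable of {vspace V} by <:].
HB.instance Definition _ (F : finFieldType) (V : vectType F) :=
  [Finite of {vspace V} by <:].

Definition grass (F : finFieldType) (V : vectType F) (l : nat) :=
  {u : {vspace V} | \dim u == l}.

Definition qbr (R : realType) (q : nat) (m : int) : R :=
  (q%:R ^ m - 1) / (q%:R - 1).

(* The length of a shortest e-path from x to y; it is #|T|, which no shortest
   path can attain, when y is not reachable from x. *)
Definition gdist (T : finType) (e : rel T) (x y : T) : nat :=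
  find (fun d => [exists p : d.-tuple T, path e x p && (last x p == y)])
       (iota 0 #|T|).

Definition grass_adj (F : finFieldType) (V : vectType F) (k : nat) :
    rel (grass V k) :=
  fun x y => (\dim (val x :&: val y))%VS == k.-1.

Definition grass_dist (F : finFieldType) (V : vectType F) (k : nat)
    (x y : grass V k) : nat :=
  gdist (@grass_adj F V k) x y.

Definition euclidean_rep (R : realType) (F : finFieldType) (V : vectType F)
    (n : nat) (E : vectType R) (dot : {dot E for idfun})
    (f : grass V 1 -> E) : Prop :=
  [/\ (\dim {: E})%:R = qbr R #|F| n - 1,
      <<codom f>>%VS = {: E}%VS,
      forall s, dot (f s) (f s) = qbr R #|F| n - 1,
      forall s t, s != t -> dot (f s) (f t) = -1
    & \sum_s f s = 0].

Definition hat (R : realType) (F : finFieldType) (V : vectType F)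
    (E : vectType R) (f : grass V 1 -> E) (u : {vspace V}) : E :=
  \sum_(s : grass V 1 | (val s <= u)%VS) f s.

Definition Bset (F : finFieldType) (V : vectType F) (k : nat)
    (x y : grass V k) : {set grass V k} :=
  [set z | grass_adj x z && (grass_dist y z == (grass_dist x y).+1)].

Definition Cset (F : finFieldType) (V : vectType F) (k : nat)
    (x y : grass V k) : {set grass V k} :=
  [set z | grass_adj x z && (grass_dist y z == (grass_dist x y).-1)].

Definition Bvec (R : realType) (F : finFieldType) (V : vectType F)
    (k : nat) (E : vectType R) (f : grass V 1 -> E) (x y : grass V k) : E :=
  \sum_(z in Bset x y) hat f (val z).

Definition Cvec (R : realType) (F : finFieldType) (V : vectType F)
    (k : nat) (E : vectType R) (f : grass V 1 -> E) (x y : grass V k) : E :=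
  \sum_(z in Cset x y) hat f (val z).

Definition Bbar (R : realType) (F : finFieldType) (V : vectType F)
    (k : nat) (E : vectType R) (f : grass V 1 -> E) (x y : grass V k) : E :=
  let q := #|F| in
  let n : int := \dim {: V} in
  let i : int := grass_dist x y in
  Bvec f x y
  - (q%:R ^ (2 * i) * qbr R q (k%:Z - i) * qbr R q (n - k%:Z - i))
    *: hat f (val x).

Definition Cbar (R : realType) (F : finFieldType) (V : vectType F)
    (k : nat) (E : vectType R) (f : grass V 1 -> E) (x y : grass V k) : E :=
  let q := #|F| in
  let i : int := grass_dist x y in
  Cvec f x y - (q%:R * qbr R q i * qbr R q (i - 2)) *: hat f (val x).

Definition Bcheck (R : realType) (F : finFieldType) (V : vectType F)
    (k : nat) (E : vectType R) (f : grass V 1 -> E) (x y : grass V k) : E :=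
  Bbar f x y.

Definition Ccheck (R : realType) (F : finFieldType) (V : vectType F)
    (k : nat) (E : vectType R) (f : grass V 1 -> E) (x y : grass V k) : E :=
  let i : int := grass_dist x y in
  Cbar f x y - (#|F|%:R ^ (i - 1)) *: (hat f (val x) + hat f (val y)).

(* Main.v *)
Require Import Defs.
From HB Require Import structures.
From mathcomp Require Import all_boot all_order all_algebra all_field.
From mathcomp Require Import reals.
From mathcomp Require Import zify ring lra.

Set Implicit Arguments.
Unset Strict Implicit.
Unset Printing Implicit Defensive.
Import Order.TTheory GRing.Theory Num.Theory.
Local Open Scope ring_scope.

(** Write [m] for (q^m - 1)/(q - 1), u^ for [hat f u] and i for the distance of
x and y, so that dim (x :&: y) = k - i ([grass_dist_eq]).  The idea is to
compute the two sums over neighbours of x in closed form, by splitting a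
neighbour z according to the hyperplane w = z :&: x of x.

The space z covers w, so it is w plus a point outside w.  Comparing dimensions
shows that z moves away from y exactly when w does not contain x :&: y and z is
not inside x + y ([dim_cap_farther]), and that it moves towards y exactly when
w contains x :&: y and z lies in w + y ([dim_cap_closer]).  Both sums thereby
become iterated sums, over w and then over z, of two kinds:
- over the spaces z covering w inside u: a point of u outside w lies in exactly
  one z and a point of w lies in all [dim u - dim w] of them
  ([sum_hat_covers]);
- over the hyperplanes w of x containing a: a point s is counted as many times
  as there are hyperplanes over a + s, that is [d] times for s in a and [d - 1]
  times for s in x outside a, where d = dim x - dim a ([sum_hat_hyperplanes]).
As the vectors of all points add up to zero, the hat of the whole space
vanishes, and the outcome is
  B = q^(2i)[k-i][n-k-i] x^ - q^(2i)[n-k-i] (x :&: y)^ - q^i[k-i] (x + y)^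
  C = q[i-1]^2 x^ + q^i[i-1] (x :&: y)^ + [i-1] (x + y)^ + q^(i-1) y^
([Bvec_formula], [Cvec_formula]).  The corrections in the definitions of the
checked vectors remove the multiples of x^ and y^, for C because
[i-1]^2 - [i][i-2] = q^(i-2).  What is left is a linear system of size two in
(x :&: y)^ and (x + y)^, whose determinant is a nonzero multiple of [n-2k] by
[n-k-i] - [k-i] = q^(k-i)[n-2k]; the theorem states its solution. *)

(** * Counting points, covers and hyperplanes *)

Section Counting.
Variables (R : realType) (F : finFieldType) (V : vectType F).
Implicit Types (u w z a x y : {vspace V}) (s : grass V 1) (m d : nat).

Local Notation q := (#|F|%:R : R).
Local Notation br m := (qbr R #|F| (Posz m)).

Definition covby w z := (w <= z)%VS && (\dim z == (\dim w).+1).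

Lemma q_gt1 : 1 < q.
Proof. by rewrite ltr1n finNzRing_gt1. Qed.

Lemma q_neq0 : q != 0.
Proof. by rewrite gt_eqF // (lt_trans ltr01 q_gt1). Qed.

Lemma q_sub1_neq0 : q - 1 != 0.
Proof. by rewrite subr_eq0 gt_eqF // q_gt1. Qed.

Lemma brE m : br m = (q ^+ m - 1) / (q - 1).
Proof. by []. Qed.

Lemma br0 : br 0 = 0.
Proof. by rewrite brE expr0 subrr mul0r. Qed.

Lemma br1 : br 1 = 1.
Proof. by rewrite brE expr1 divff // q_sub1_neq0. Qed.

Lemma brD m d : br (m + d) = br m + q ^+ m * br d.
Proof. by rewrite !brE exprD; field; exact: q_sub1_neq0. Qed.

Lemma brS m : br m.+1 = br m + q ^+ m.
Proof. by rewrite -addn1 brD br1 mulr1. Qed.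

Lemma br_neq0 m : (0 < m)%N -> br m != 0.
Proof.
move=> m0; rewrite brE mulf_neq0 ?invr_neq0 ?q_sub1_neq0 // subr_eq0 gt_eqF //.
by rewrite exprn_egt1 ?q_gt1 // -lt0n.
Qed.

Lemma dim_point s : \dim (val s) = 1%N.
Proof. exact/eqP/(valP s). Qed.

Lemma dim_add_point u s : ~~ (val s <= u)%VS -> \dim (u + val s) = (\dim u).+1.
Proof.
move=> su; have := dimv_sum_cap u (val s).
suff -> : \dim (u :&: val s) = 0%N by rewrite dim_point; lia.
apply/eqP; apply: contraNT su => d0; apply/capv_idPr/eqP.
by rewrite eqEdim capvSr dim_point lt0n.
Qed.

Lemma dim_covby w z : covby w z -> \dim z = (\dim w).+1.
Proof. by case/andP=> _ /eqP. Qed.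

Lemma covby_point w z s :
  covby w z -> ~~ (val s <= w)%VS -> (val s <= z)%VS -> z = (w + val s)%VS.
Proof.
case/andP=> wz /eqP dz sw sz; apply/esym/eqP.
by rewrite eqEdim dim_add_point // dz leqnn andbT subv_add wz.
Qed.

Lemma covby_mid w u z : covby w z -> (w <= u)%VS -> (u <= z)%VS -> u != z -> u = w.
Proof.
move=> /dim_covby dz wu uz; rewrite eqEdim uz /= dz -ltnNge => du.
by apply/esym/eqP; rewrite eqEdim wu -ltnS.
Qed.

(** The finite type structure lives on an alias of V, whose vector space
structure agrees with that of V only once V is a constructor application;
hence the case analysis on V. *)
Lemma card_finvect u :
  #|[pred v : finvect_type V | (v : V) \in u]| = (#|F| ^ \dim u)%N.
Proof.
case: V u => T cT u.
exact: (@card_vspace F (finvect_type (Vector.Pack cT)) cT u).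
Qed.

(** Double counting of pairs of a nonzero vector and a point containing it:
each nonzero vector spans one point, each point has q - 1 nonzero vectors. *)
Lemma nat_card_points u :
  (#|[pred s : grass V 1 | (val s <= u)%VS]| * (#|F| - 1) = #|F| ^ \dim u - 1)%N.
Proof.
pose T := finvect_type V.
have cardnz (w : {vspace V}) :
    (\sum_(v : T | ((v : V) \in w) && ((v : V) != 0%R)) 1 = #|F| ^ \dim w - 1)%N.
  have <- := card_finvect w.
  rewrite sum1_card [in RHS](cardD1 (0%R : T)) inE mem0v add1n subn1 /=.
  by apply: eq_card => v; rewrite !inE andbC.
rewrite -sum1_card big_distrl /=.
transitivity (\sum_(s : grass V 1 | (val s <= u)%VS)
                \sum_(v : T | ((v : V) \in val s) && ((v : V) != 0%R)) 1)%N.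
  by apply: eq_bigr => s _; rewrite cardnz dim_point expn1 mul1n.
rewrite -cardnz (exchange_big_dep (fun v : T => ((v : V) \in u) && ((v : V) != 0%R))) /=.
  apply: eq_bigr => v /andP[vu v0].
  have dv : \dim <[(v : V)]> == 1%N by rewrite dim_vline v0.
  rewrite (big_pred1 (Sub <[(v : V)]>%VS dv : grass V 1)) // => s /=.
  rewrite v0 andbT -val_eqE /= eqEdim dim_point (eqP dv) leqnn andbT.
  apply/andP/idP => [[_ vs]|sv].
    rewrite -(eqP (_ : <[v : V]>%VS == val s)) //.
    by rewrite eqEdim dim_point (eqP dv) leqnn andbT.
  have /eqP sE : val s == <[v : V]>%VS by rewrite eqEdim sv dim_point (eqP dv).
  by rewrite sE memv_line -memvE.
by move=> s v su /andP[vs ->]; rewrite andbT (subvP su).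
Qed.

Lemma card_points u : \sum_(s : grass V 1 | (val s <= u)%VS) 1 = br (\dim u).
Proof.
have q1 := finNzRing_gt1 F; rewrite brE.
apply: (mulIf q_sub1_neq0); rewrite divfK ?q_sub1_neq0 //.
have := congr1 (fun m => m%:R : R) (nat_card_points u).
rewrite natrM !natrB ?natrX ?expn_gt0 ?(ltnW q1) //.
by rewrite sumr_const.
Qed.

Lemma card_points_diff w u : (w <= u)%VS ->
  \sum_(s : grass V 1 | (val s <= u)%VS && ~~ (val s <= w)%VS) 1
    = br (\dim u) - br (\dim w).
Proof.
move=> wu; rewrite -!card_points [X in _ = X - _](bigID (fun s => (val s <= w)%VS)) /=.
rewrite [X in X + _ - _](eq_bigl (fun s => (val s <= w)%VS)).
  by rewrite addrAC subrr add0r.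
move=> s; apply/andP/idP => [[]//|sw].
by rewrite (subv_trans sw wu).
Qed.

(** Double counting of pairs (s, z) with the point s in z but not in w: such an
s determines z as w + s, while a cover z of w has q ^ dim w such points. *)
Lemma card_covers w u : (w <= u)%VS ->
  \sum_(z | covby w z && (z <= u)%VS) 1 = br (\dim u - \dim w).
Proof.
move=> wu; have dwu := dimvS wu.
have qw : q ^+ \dim w != 0 by rewrite expf_neq0 // q_neq0.
apply: (mulfI qw); have := brD (\dim w) (\dim u - \dim w).
rewrite subnKC // => E; apply/esym.
rewrite -[LHS](addKr (br (\dim w))) -{}E addrC -card_points_diff // mulr_sumr.
transitivity (\sum_(s : grass V 1 | (val s <= u)%VS && ~~ (val s <= w)%VS)
   \sum_(z | [&& covby w z, (z <= u)%VS & (val s <= z)%VS]) (1 : R)).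
  apply: eq_bigr => s /andP[su sw].
  rewrite (big_pred1 (w + val s)%VS) // => z /=; apply/and3P/eqP => [[wz _ sz]|->].
    exact: covby_point wz sw sz.
  by rewrite /covby addvSl addvSr subv_add wu su dim_add_point ?eqxx.
rewrite (exchange_big_dep (fun z => covby w z && (z <= u)%VS)) /=; last first.
  by move=> s z _ /and3P[-> -> _].
apply: eq_bigr => z /andP[wz zu]; rewrite mulr1.
rewrite (eq_bigl (fun s => (val s <= z)%VS && ~~ (val s <= w)%VS)); last first.
  move=> s /=; rewrite wz zu /=.
  case: (boolP (val s <= z)%VS) => [sz|]; last by rewrite andbF.
  by rewrite (subv_trans sz zu) andbT.
rewrite card_points_diff; last by case/andP: wz.
by rewrite (dim_covby wz) brS addrAC subrr add0r.
Qed.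

(** Induction on d = dim x - dim a.  For d at least 2 one double counts the
pairs (s, w) of a point s of x outside a and a hyperplane w over a: the number
N of hyperplanes is split, for each s, into those through s, of which there are
[d - 1] by induction applied to a + s, and those missing s; summed over s, the
latter contribute N times the number of points of x outside a hyperplane.  This
gives a linear equation for N. *)
Lemma card_hyperplanes a x : (a <= x)%VS ->
  \sum_(w | (a <= w)%VS && covby w x) 1 = br (\dim x - \dim a).
Proof.
move=> ax; move dE: (\dim x - \dim a)%N => d.
elim: d a ax dE => [|[|d] IH] a ax dE.
- rewrite br0 big_pred0 // => w; apply/negP => /andP[/dimvS aw /dim_covby]; lia.
- have dxa := dimvS ax; rewrite br1 (big_pred1 a) // => w; apply/andP/eqP => [[aw wx]|->].
    by apply/eqP; rewrite eq_sym eqEdim aw /=; move/dim_covby: wx; lia.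
  by rewrite /covby subvv ax; split=> //=; lia.
set N := LHS.
have dxa := dimvS ax; have dmE : \dim x = (\dim a + d.+2)%N by lia.
have N1 s : (val s <= x)%VS && ~~ (val s <= a)%VS ->
    \sum_(w | (a <= w)%VS && covby w x && (val s <= w)%VS) (1 : R) = br d.+1.
  case/andP=> sx sa; rewrite -(IH (a + val s)%VS) ?subv_add ?ax //; last first.
    by rewrite dim_add_point //; lia.
  by apply: eq_bigl => w; rewrite subv_add andbAC.
have E : (br (\dim x) - br (\dim a)) * N
    = (br (\dim x) - br (\dim a)) * br d.+1 + N * q ^+ (\dim a + d.+1).
  rewrite -card_points_diff // !mulr_suml /N -/N.
  (* For each s, split the hyperplanes over a by whether they contain s. *)
  transitivity (\sum_(s : grass V 1 | (val s <= x)%VS && ~~ (val s <= a)%VS)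
    (br d.+1 + \sum_(w | (a <= w)%VS && covby w x && ~~ (val s <= w)%VS) (1 : R))).
    apply: eq_bigr => s sxa; rewrite mul1r /N (bigID (fun w => (val s <= w)%VS)) /=.
    by rewrite N1.
  rewrite big_split /=; congr (_ + _); first by apply: eq_bigr => s _; rewrite mul1r.
  rewrite (exchange_big_dep (fun w => (a <= w)%VS && covby w x)) /=; last first.
    by move=> s w _ /andP[].
  apply: eq_bigr => w /andP[aw wx].
  rewrite (eq_bigl (fun s => (val s <= x)%VS && ~~ (val s <= w)%VS)); last first.
    move=> s /=; rewrite aw wx /=.
    case: (boolP (val s <= w)%VS); rewrite ?andbF //= => sw.
    by rewrite !andbT (contraNN (fun sa => subv_trans sa aw) sw) andbT.
  rewrite card_points_diff; last by case/andP: wx.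
  have := dim_covby wx; rewrite dmE addnS => -[<-].
  by rewrite brS; ring.
move: E; rewrite dmE brD.
have -> : br (\dim a) + q ^+ \dim a * br d.+2 - br (\dim a)
    = q ^+ \dim a * br d.+2 by ring.
rewrite exprD => E.
have qa : q ^+ \dim a != 0 by rewrite expf_neq0 // q_neq0.
have b0 : br d.+1 != 0 by rewrite br_neq0.
apply: (mulfI b0); apply: (mulfI qa); move: E; rewrite brS => E.
lra.
Qed.

End Counting.

(** * Sums of hats *)

Section Hat.
Variables (R : realType) (F : finFieldType) (V : vectType F).
Variables (E : vectType R) (f : grass V 1 -> E).
Implicit Types (u w z a x y : {vspace V}) (s : grass V 1) (m d : nat).

Local Notation q := (#|F|%:R : R).
Local Notation br m := (qbr R #|F| (Posz m)).

Lemma hatE u : hat f u = \sum_s ((val s <= u)%VS%:R : R) *: f s.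
Proof.
rewrite /hat big_mkcond; apply: eq_bigr => s _.
by case: (val s <= u)%VS; rewrite ?scale1r ?scale0r.
Qed.

(** Sums of hats are determined by how often each point is covered, which
reduces the next two formulas to counting. *)
Lemma sum_hat (P : pred {vspace V}) :
  \sum_(z | P z) hat f z =
  \sum_s (\sum_(z | P z && (val s <= z)%VS) (1 : R)) *: f s.
Proof.
under eq_bigr do rewrite hatE.
rewrite exchange_big /=; apply: eq_bigr => s _; rewrite -scaler_suml; congr (_ *: _).
by rewrite big_mkcondr; apply: eq_bigr => z _; case: (_ <= z)%VS.
Qed.

Lemma sum_hat_covers w u : (w <= u)%VS ->
  \sum_(z | covby w z && (z <= u)%VS) hat f z
    = (br (\dim u - \dim w) - 1) *: hat f w + hat f u.
Proof.
move=> wu; rewrite sum_hat !hatE scaler_sumr -big_split; apply: eq_bigr => s _ /=.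
rewrite scalerA -scalerDl; congr (_ *: _).
have [sw|sw] := boolP (val s <= w)%VS.
  rewrite (subv_trans sw wu) mulr1 subrK -card_covers //.
  apply: eq_bigl => z; case: (boolP (covby w z)) => //= /andP[wz _].
  by rewrite (subv_trans sw wz) andbT.
rewrite mulr0 add0r; have [su|su] := boolP (val s <= u)%VS.
  rewrite (big_pred1 (w + val s)%VS) // => z /=.
  apply/andP/eqP => [[/andP[wz _] sz]|->]; first exact: covby_point wz sw sz.
  by rewrite /covby addvSl addvSr subv_add wu su dim_add_point ?eqxx.
rewrite big_pred0 // => z; apply/negP => /andP[/andP[_ zu] sz].
by case/negP: su; exact: subv_trans zu.
Qed.

Lemma sum_hat_hyperplanes a x : (a <= x)%VS -> (\dim a < \dim x)%N ->
  \sum_(w | (a <= w)%VS && covby w x) hat f w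
    = br (\dim x - \dim a).-1 *: hat f x
      + q ^+ (\dim x - \dim a).-1 *: hat f a.
Proof.
move=> ax dax; rewrite sum_hat !hatE !scaler_sumr -big_split; apply: eq_bigr => s _ /=.
rewrite !scalerA -scalerDl; congr (_ *: _).
have [sx|sx] := boolP (val s <= x)%VS; last first.
  rewrite big_pred0 => [|w]; last first.
    apply/negP => /andP[/andP[_ /andP[wx _]] sw].
    by case/negP: sx; exact: subv_trans wx.
  case: (boolP (val s <= a)%VS) => [sa|]; last by rewrite !mulr0 addr0.
  by case/negP: sx; exact: subv_trans ax.
transitivity (\sum_(w | (a + val s <= w)%VS && covby w x) (1 : R)).
  by apply: eq_bigl => w; rewrite subv_add andbAC.
rewrite card_hyperplanes ?subv_add ?ax //.
have [sa|sa] := boolP (val s <= a)%VS.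
  by rewrite (addv_idPl sa) !mulr1 -brS prednK // subn_gt0.
by rewrite dim_add_point // subnS mulr0 addr0 mulr1.
Qed.

Lemma hat_zero : hat f 0%VS = 0.
Proof.
rewrite /hat big_pred0 // => s; apply/negP => /dimvS.
by rewrite dim_point dimv0.
Qed.

Lemma hat_full : \sum_s f s = 0 -> hat f fullv = 0.
Proof. by move=> f0; rewrite -[RHS]f0; apply: eq_bigl => s; rewrite subvf. Qed.

End Hat.

(** * Neighbours in terms of hyperplanes *)

Section Neighbours.
Variables (R : realType) (F : finFieldType) (V : vectType F).
Variables (E : vectType R) (f : grass V 1 -> E).
Implicit Types (w z : {vspace V}).

Variables (k i : nat) (x y : {vspace V}).
Hypotheses (dx : \dim x = k) (dy : \dim y = k)
  (dxy : \dim (x :&: y) = (k - i)%N) (i0 : (0 < i)%N) (ik : (i < k)%N).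

Lemma dim_addv_xy : \dim (x + y) = (k + i)%N.
Proof. by have := dimv_sum_cap x y; lia. Qed.

Lemma dim_modular w z : (w <= z)%VS ->
  (\dim (w + z :&: y) + \dim (w :&: y) = \dim w + \dim (z :&: y))%N.
Proof. by move=> wz; rewrite -[RHS]dimv_sum_cap capvA (capv_idPl wz). Qed.

Lemma hyperplane_add w : covby w x -> ~~ (x :&: y <= w)%VS -> (w + x :&: y = x)%VS.
Proof.
move=> wx xyw; have [w_x _] := andP wx.
apply/eqP; apply: contraNT xyw => /(covby_mid wx).
rewrite addvSl subv_add w_x capvSl => /(_ isT isT) <-.
exact: addvSr.
Qed.

Lemma dim_hyperplane_cap w : covby w x ->
  \dim (w :&: y) = if (x :&: y <= w)%VS then (k - i)%N else (k - i.+1)%N.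
Proof.
move=> wx; have [w_x _] := andP wx; have dw := dim_covby wx.
case: ifPn => [xyw|xyw].
  rewrite -dxy; congr (\dim _); apply: subv_anti.
  by rewrite capvS //= subv_cap xyw capvSr.
by have := dim_modular w_x; rewrite hyperplane_add // dxy; lia.
Qed.

(** If w contains x :&: y, so does z, and its intersection with y is too large.
Otherwise w + y = x + y, so that z inside x + y gains a dimension of y over w
by the modular law, whereas z outside x + y meets y inside w. *)
Lemma dim_cap_farther w z : covby w x -> covby w z -> (z :&: x)%VS = w ->
  (\dim (z :&: y) == k - i.+1)%N = ~~ (x :&: y <= w)%VS && ~~ (z <= x + y)%VS.
Proof.
move=> wx wz zxw; have [w_x _] := andP wx; have dw := dim_covby wx.
have [w_z _] := andP wz; have dz := dim_covby wz.
have dwy := dim_hyperplane_cap wx; have := dim_modular w_z; rewrite {}dwy.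
case: ifPn => xyw /= dzy.
  have : (x :&: y <= z :&: y)%VS by rewrite subv_cap capvSr (subv_trans xyw).
  by move/dimvS; rewrite dxy; lia.
have wy : (w + y = x + y)%VS.
  by rewrite -{1}(hyperplane_add wx xyw) -addvA (addv_idPr (capvSr x y)).
have [zxy|zxy] := boolP (z <= x + y)%VS.
  have zE : (w + z :&: y = z)%VS.
    by rewrite (capvC z) vspace_modl // wy; apply/capv_idPr.
  by move: dzy; rewrite zE; lia.
have zE : (z :&: (x + y) = w)%VS.
  apply: (covby_mid wz); rewrite ?capvSl ?subv_cap ?w_z ?(subv_trans w_x (addvSl _ _)) //.
  by apply: contraNneq zxy => <-; exact: capvSr.
have : (z :&: y <= w)%VS by rewrite -zE capvS // addvSr.
by move/addv_idPl => zyw; move: dzy; rewrite zyw; lia.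
Qed.

(** By the modular law z :&: y exceeds w :&: y in dimension, necessarily by
one, exactly when z lies in w + y; and w :&: y must already have the maximal
dimension k - i, which means that w contains x :&: y. *)
Lemma dim_cap_closer w z : covby w x -> covby w z -> (z :&: x)%VS = w ->
  (\dim (z :&: y) == (k - i).+1)%N = (x :&: y <= w)%VS && (z <= w + y)%VS.
Proof.
move=> wx wz zxw; have [w_x _] := andP wx; have dw := dim_covby wx.
have [w_z _] := andP wz; have dz := dim_covby wz.
have dwy := dim_hyperplane_cap wx; have := dim_modular w_z; rewrite {}dwy.
have le : (w + z :&: y <= z)%VS by rewrite subv_add w_z capvSl.
case: ifPn => xyw /= dzy; last by move/dimvS: le; lia.
have [zwy|zwy] := boolP (z <= w + y)%VS.
  have zE : (w + z :&: y = z)%VS.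
    by rewrite (capvC z) vspace_modl //; apply/capv_idPr.
  by move: dzy; rewrite zE; lia.
have zE : (w + z :&: y = w)%VS.
  apply: (covby_mid wz) => //; first exact: addvSl.
  apply: contraNneq zwy => <-; rewrite addvS //; exact: capvSr.
by move: dzy; rewrite zE; lia.
Qed.

Lemma adjacent_covby z : \dim z = k -> \dim (z :&: x) = k.-1 ->
  covby (z :&: x) x /\ covby (z :&: x) z.
Proof.
by move=> dz dzx; rewrite /covby capvSl capvSr dx dz dzx !prednK ?eqxx //; lia.
Qed.

Lemma sum_farther :
  \sum_(z | [&& \dim z == k, \dim (z :&: x) == k.-1 & \dim (z :&: y) == k - i.+1]%N)
    hat f z
  = \sum_(w | covby w x && ~~ (x :&: y <= w)%VS)
      \sum_(z | covby w z && ~~ (z <= x + y)%VS) hat f z.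
Proof.
rewrite (partition_big (fun z => z :&: x)%VS
  (fun w => covby w x && ~~ (x :&: y <= w)%VS)) /=.
  apply: eq_bigr => w /andP[wx xyw]; apply: eq_bigl => z.
  apply/andP/andP => [[/and3P[/eqP dz /eqP dzx dzy] /eqP zxw]|[wz zxy]].
    have [_ wz] := adjacent_covby dz dzx; rewrite zxw in wz.
    by move: dzy; rewrite (dim_cap_farther wx wz zxw) => /andP[_ ->].
  have [w_x _] := andP wx; have dw := dim_covby wx.
  have [w_z _] := andP wz; have dz := dim_covby wz.
  have zxw : (z :&: x = w)%VS.
    apply: (covby_mid wz); rewrite ?subv_cap ?w_z ?capvSl //.
    by apply: contraNneq zxy => <-; exact: subv_trans (capvSr _ _) (addvSl _ _).
  by rewrite (dim_cap_farther wx wz zxw) zxy xyw zxw eqxx; split=> //; lia.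
move=> z /and3P[/eqP dz /eqP dzx dzy]; have [zx wz] := adjacent_covby dz dzx.
by rewrite zx; move: dzy; rewrite (dim_cap_farther zx wz) // => /andP[->].
Qed.

Lemma sum_closer :
  \sum_(z | [&& \dim z == k, \dim (z :&: x) == k.-1 & \dim (z :&: y) == (k - i).+1]%N)
    hat f z
  = \sum_(w | (x :&: y <= w)%VS && covby w x)
      \sum_(z | covby w z && (z <= w + y)%VS) hat f z.
Proof.
rewrite (partition_big (fun z => z :&: x)%VS
  (fun w => (x :&: y <= w)%VS && covby w x)) /=.
  apply: eq_bigr => w /andP[xyw wx]; apply: eq_bigl => z.
  apply/andP/andP => [[/and3P[/eqP dz /eqP dzx dzy] /eqP zxw]|[wz zwy]].
    have [_ wz] := adjacent_covby dz dzx; rewrite zxw in wz.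
    by move: dzy; rewrite (dim_cap_closer wx wz zxw) => /andP[_ ->].
  have [w_x _] := andP wx; have dw := dim_covby wx.
  have [w_z _] := andP wz; have dz := dim_covby wz.
  have zxw : (z :&: x = w)%VS.
    apply: subv_anti; rewrite subv_cap w_z w_x !andbT.
    apply: (subv_trans (capvS zwy (subvv x))).
    by rewrite -vspace_modl // subv_add subvv capvC.
  by rewrite (dim_cap_closer wx wz zxw) zwy xyw zxw eqxx; split=> //; lia.
move=> z /and3P[/eqP dz /eqP dzx dzy]; have [zx wz] := adjacent_covby dz dzx.
by rewrite zx andbT; move: dzy; rewrite (dim_cap_closer zx wz) // => /andP[->].
Qed.

(** By the modular law, adding y and meeting with x are inverse bijections
between the hyperplanes of x over x :&: y and the hyperplanes of x + y over y. *)
Lemma sum_hat_join :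
  \sum_(w | (x :&: y <= w)%VS && covby w x) hat f (w + y)
  = \sum_(h | (y <= h)%VS && covby h (x + y)) hat f h.
Proof.
rewrite [RHS](reindex_onto (fun w => w + y)%VS (fun h => h :&: x)%VS) /=.
  apply: eq_bigl => w; rewrite addvSr /covby dim_addv_xy dx.
  apply/and3P/andP => [[xyw wx /eqP dw]|[/andP[wyxy /eqP dwy] /eqP wE]].
    have wE : ((w + y) :&: x = w)%VS.
      by rewrite -vspace_modl //; apply/addv_idPl; rewrite capvC.
    have := dim_hyperplane_cap (_ : covby w x).
    rewrite /covby wx dx dw eqxx xyw => /(_ isT) dwy.
    have := dimv_sum_cap w y; rewrite wE eqxx addvS //=; lia.
  have xyw : (x :&: y <= w)%VS.
    by rewrite -wE subv_cap capvSl (subv_trans (capvSr _ _)) ?addvSr.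
  have w_x : (w <= x)%VS by rewrite -wE capvSr.
  rewrite xyw w_x; split=> //.
  have xywy : (x :&: y = w :&: y)%VS.
    by apply: subv_anti; rewrite subv_cap xyw capvSr capvS.
  by have := dimv_sum_cap w y; rewrite -xywy dxy; lia.
move=> h /andP[yh /andP[hxy _]]; rewrite capvC addvC vspace_modl //.
by apply/capv_idPr; rewrite addvC.
Qed.

End Neighbours.

(** * Distance in the Grassmann graph *)

(** The search behind [gdist] stops before #|T|: a path of minimal length has no
repeated vertex. *)
Lemma gdist_min_path (T : finType) (e : rel T) (x y : T) (p : seq T) :
  path e x p -> last x p = y ->
  (forall p', path e x p' -> last x p' = y -> (size p <= size p')%N) ->
  gdist e x y = size p.
Proof.
move=> ep py min_p.
have ltT : (size p < #|T|)%N.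
  case/shortenP: ep py => p' ep' /card_uniqP sp' _ p'y.
  apply: leq_ltn_trans (min_p p' ep' p'y) _.
  by rewrite [X in (X <= _)%N](esym sp') max_card.
set Q := fun d => [exists p : d.-tuple T, path e x p && (last x p == y)].
have Qp : Q (size p).
  by apply/existsP; exists (in_tuple p); rewrite ep py eqxx.
have nQ d : (d < size p)%N -> ~~ Q d.
  move=> ltd; apply/existsP => -[t /andP[et /eqP ty]].
  by have := min_p t et ty; rewrite size_tuple leqNgt ltd.
rewrite /gdist -/Q; have hasQ : has Q (iota 0 #|T|).
  by apply/hasP; exists (size p); rewrite ?mem_iota.
have lt_find : (find Q (iota 0 #|T|) < #|T|)%N.
  by rewrite -{2}(size_iota 0 #|T|) -has_find.
apply/eqP; rewrite eqn_leq; apply/andP; split; rewrite leqNgt; apply/negP.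
  by move=> lt_p; have := before_find 0%N lt_p; rewrite nth_iota // Qp.
by move/nQ; have := nth_find 0%N hasQ; rewrite nth_iota // => ->.
Qed.

Lemma exists_point (F : finFieldType) (V : vectType F) (w u : {vspace V}) :
  ~~ (u <= w)%VS -> exists2 s : grass V 1, (val s <= u)%VS & ~~ (val s <= w)%VS.
Proof.
case/subvPn=> v vu vw; have dv : \dim <[v]> == 1%N.
  by rewrite dim_vline; case: (eqVneq v 0) vw => [->|] //; rewrite mem0v.
by exists (Sub <[v]>%VS dv : grass V 1); rewrite SubK -memvE.
Qed.

Lemma exists_hyperplane (F : finFieldType) (V : vectType F) (a x : {vspace V}) :
  (a <= x)%VS -> (\dim a < \dim x)%N ->
  exists2 w, (a <= w)%VS & covby w x.
Proof.
move=> ax lt; move dE: (\dim x - \dim a)%N => d.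
elim: d a ax lt dE => [|[|d] IH] a ax lt dE; first lia.
  by exists a; rewrite ?subvv // /covby ax /=; lia.
have [|s sx sa] := @exists_point _ _ a x.
  by apply/negP => /dimvS; lia.
have da := dim_add_point sa.
have [|||w aw wx] := IH (a + val s)%VS; rewrite ?subv_add ?ax ?da //; try lia.
by exists w => //; apply: subv_trans aw; exact: addvSl.
Qed.

Section Distance.
Variables (F : finFieldType) (V : vectType F) (k : nat).
Hypothesis k0 : (0 < k)%N.
Implicit Types x y z : grass V k.
Local Notation adj := (@grass_adj F V k).

Lemma dim_grass x : \dim (val x) = k.
Proof. exact/eqP/(valP x). Qed.

Lemma adj_dim_cap x z (u : {vspace V}) : adj x z ->
  (\dim (val z :&: u) <= (\dim (val x :&: u)).+1)%N.
Proof.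
move=> /eqP xz; have := dimv_sum_cap (val x :&: val z) (val z :&: u).
have : (val x :&: val z + val z :&: u <= val z)%VS by rewrite subv_add capvSr capvSl.
have : (val x :&: val z :&: (val z :&: u) <= val x :&: u)%VS.
  rewrite subv_cap (subv_trans (capvSl _ _)) ?capvSl //=.
  by rewrite (subv_trans (capvSr _ _)) ?capvSr.
move=> /dimvS d1 /dimvS; rewrite dim_grass xz; lia.
Qed.

Lemma path_dim_cap x (u : {vspace V}) p : path adj x p ->
  (\dim (val (last x p) :&: u) <= \dim (val x :&: u) + size p)%N.
Proof.
elim: p x => [|z p IH] x /=; first by rewrite addn0.
case/andP=> xz zp; apply: leq_trans (IH z zp) _.
by rewrite addnS -addSn leq_add2r; exact: adj_dim_cap.
Qed.

(** The neighbour is w + s for a hyperplane w of x over x :&: y and a point s of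
y outside x. *)
Lemma closer_neighbour x y : x != y ->
  exists2 z, adj x z & \dim (val z :&: val y) = (\dim (val x :&: val y)).+1.
Proof.
move=> xy; have nyx : ~~ (val y <= val x)%VS.
  apply: contraNN xy => yx; rewrite -val_eqE eq_sym eqEdim yx /=.
  by rewrite !dim_grass.
have nxy : ~~ (val x <= val y)%VS.
  apply: contraNN xy => yx; rewrite -val_eqE eqEdim yx /=.
  by rewrite !dim_grass.
have [s sy sx] := exists_point nyx.
have lt : (\dim (val x :&: val y) < \dim (val x))%N.
  rewrite ltnNge; apply: contraNN nxy => le; apply/capv_idPl/eqP.
  by rewrite eqEdim capvSl.
have [w aw wx] := exists_hyperplane (capvSl _ _) lt.
have [w_x _] := andP wx; have := dim_covby wx; rewrite dim_grass => dw.
have sw : ~~ (val s <= w)%VS by apply: contraNN sx => sw; exact: subv_trans w_x.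
have dz : \dim (w + val s) == k by rewrite dim_add_point // dw.
have sxw : (val x :&: (w + val s) = w)%VS.
  apply: (@covby_mid _ _ w _ (w + val s)%VS).
  - by rewrite /covby addvSl dim_add_point ?eqxx.
  - by rewrite subv_cap w_x addvSl.
  - exact: capvSr.
  - apply: contraNneq sx => sxE; apply: subv_trans (capvSl _ (w + val s)%VS).
    by rewrite sxE addvSr.
exists (Sub (w + val s)%VS dz); first by rewrite /grass_adj /= sxw dw.
rewrite -(dim_add_point (u := (val x :&: val y)%VS) (s := s)); last first.
  by apply: contraNN sx => sxy; exact: subv_trans (capvSl _ (val y)).
congr (\dim _); apply: subv_anti.
rewrite SubK subv_cap !subv_add (subv_trans aw) ?addvSl ?addvSr ?capvSr ?sy //= andbT.
by rewrite addvC -vspace_modl // addvC addvS // capvS.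
Qed.

(** One step raises dim (x :&: y) by at most one, and some step raises it as
long as x differs from y. *)
Lemma grass_dist_eq x y : grass_dist x y = (k - \dim (val x :&: val y))%N.
Proof.
have bound p : path adj x p -> last x p = y ->
    (k - \dim (val x :&: val y) <= size p)%N.
  by move=> /(path_dim_cap (val y)) le_p xy; move: le_p; rewrite xy capvv dim_grass; lia.
suff [p [xp py sp]] : exists p, [/\ path adj x p, last x p = y &
    size p = (k - \dim (val x :&: val y))%N].
  by rewrite /grass_dist (gdist_min_path xp py) // => p' xp' py'; rewrite sp bound.
move dE: (k - _)%N => d; elim: d x dE {bound} => [|d IH] x dE.
  exists [::]; split=> //=; apply: val_inj; apply/eqP.
  have dxy : (k <= \dim (val x :&: val y))%N by lia.
  have /eqP xE : (val x :&: val y == val x)%VS by rewrite eqEdim capvSl dim_grass.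
  by rewrite eqEdim !dim_grass leqnn andbT; apply/capv_idPl.
have [z xz dz] : exists2 z, adj x z &
    \dim (val z :&: val y) = (\dim (val x :&: val y)).+1.
  by apply: closer_neighbour; apply/eqP => xy; move: dE; rewrite xy capvv dim_grass; lia.
have [|p [zp py sp]] := IH z; first by rewrite dz; lia.
by exists (z :: p); rewrite /= xz zp py sp.
Qed.

End Distance.

(** * The sums over neighbours in closed form *)

Lemma sum_grass (F : finFieldType) (V : vectType F) (k : nat) (E : nmodType)
    (P : pred {vspace V}) (h : {vspace V} -> E) :
  \sum_(z : grass V k | P (val z)) h (val z) = \sum_(u | (\dim u == k) && P u) h u.
Proof.
rewrite [RHS](reindex_omap val (insub : {vspace V} -> option (grass V k))) /=.
  by apply: eq_bigl => z; rewrite valK eqxx andbT (valP z).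
by move=> u /andP[du _]; rewrite insubT.
Qed.

Section ClosedForms.
Variables (R : realType) (F : finFieldType) (V : vectType F).
Variables (E : vectType R) (f : grass V 1 -> E).
Variables (k : nat) (x y : grass V k).
Local Notation q := (#|F|%:R : R).
Local Notation br m := (qbr R #|F| (Posz m)).
Variable i : nat.
Hypotheses (di : grass_dist x y = i) (i1 : (1 < i)%N) (ik : (i < k)%N).

Let k0 : (0 < k)%N. Proof. by lia. Qed.
Let dx := dim_grass x.
Let dy := dim_grass y.

Lemma dim_cap_grass : \dim (val x :&: val y) = (k - i)%N.
Proof.
have := grass_dist_eq k0 x y; rewrite di; have := dimvS (capvSl (val x) (val y)).
by rewrite dx; lia.
Qed.
Let dxy := dim_cap_grass.

Lemma Cvec_subspaces : Cvec f x y =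
  \sum_(u | [&& \dim u == k, \dim (u :&: val x) == k.-1
              & \dim (u :&: val y) == (k - i).+1]%N) hat f u.
Proof.
rewrite -(sum_grass k (fun u => (\dim (u :&: val x) == k.-1)
                             && (\dim (u :&: val y) == (k - i).+1)%N)).
apply: eq_bigl => z; rewrite inE /grass_adj capvC; congr (_ && _).
rewrite di (grass_dist_eq k0 y z) capvC.
have := dimvS (capvSr (val z) (val y)); rewrite dy; lia.
Qed.

Lemma Cvec_formula : Cvec f x y =
  (q * br i.-1 ^+ 2) *: hat f (val x)
  + (q ^+ i * br i.-1) *: hat f (val x :&: val y)%VS
  + br i.-1 *: hat f (val x + val y)%VS + q ^+ i.-1 *: hat f (val y).
Proof.
rewrite Cvec_subspaces (sum_closer f dx dy dxy (ltnW i1) ik).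
(* The covers of w inside w + y number [i], since dim (w + y) = dim w + i. *)
rewrite (eq_bigr (fun w => (br i - 1) *: hat f w + hat f (w + val y)%VS)); last first.
  move=> w /andP[xyw wx]; rewrite sum_hat_covers ?addvSl //.
  have := dim_covby wx; rewrite dx => dw.
  have := dim_hyperplane_cap dx dy dxy (ltnW i1) ik wx; rewrite xyw => dwy.
  have := dimv_sum_cap w (val y); rewrite dwy dy => d.
  by congr ((br _ - 1) *: _ + _); lia.
have lt_xy : (\dim (val x :&: val y) < \dim (val x))%N by rewrite dxy dx; lia.
have dxay := dim_addv_xy dx dy dxy (ltnW i1) ik.
have lt_y : (\dim (val y) < \dim (val x + val y))%N by rewrite dxay dy; lia.
rewrite big_split /= -scaler_sumr (sum_hat_hyperplanes f (capvSl _ _) lt_xy).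
rewrite (sum_hat_join f dx dy dxy (ltnW i1) ik).
rewrite (sum_hat_hyperplanes f (addvSr _ _) lt_y) dxay dx dy dxy.
have -> : ((k - (k - i)).-1 = i.-1)%N by lia.
have -> : ((k + i - k).-1 = i.-1)%N by lia.
have -> : br i = 1 + q * br i.-1.
  by have := brD R F 1 i.-1; rewrite br1 expr1 add1n prednK // ltnW.
have -> : q ^+ i = q * q ^+ i.-1 by rewrite -exprS prednK // ltnW.
rewrite scalerDr !scalerA !addrA.
by congr (_ *: _ + _ *: _ + _ + _); ring.
Qed.

(** The coefficient of x^ cancels by [i-1]^2 = [i][i-2] + q^(i-2). *)
Lemma Ccheck_formula : Ccheck f x y =
  (q ^+ i * br i.-1) *: hat f (val x :&: val y)%VS
  + br i.-1 *: hat f (val x + val y)%VS.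
Proof.
rewrite /Ccheck /Cbar Cvec_formula di.
have -> : i%:Z - 1 = i.-1 by lia.
have [m im] : exists m, i = m.+2 by exists (i - 2)%N; lia.
have -> : i%:Z - 2 = m by lia.
rewrite -exprnP im /=.
have -> : q * br m.+1 ^+ 2 = q * br m.+2 * br m + q ^+ m.+1.
  rewrite !brS !exprS (brE R F m).
  by move: (q_sub1_neq0 R F); move: q => Q Q1; field.
rewrite scalerDl scalerDr -addrA -opprD; apply: (canLR (addrK _)); rewrite !addrA.
by rewrite [LHS](ACl (3*4*1*2*5)).
Qed.

Variable n : nat.
Hypotheses (dV : \dim {: V} = n) (kn : (2 * k < n)%N) (f0 : \sum_s f s = 0).

Lemma Bvec_subspaces : Bvec f x y =
  \sum_(u | [&& \dim u == k, \dim (u :&: val x) == k.-1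
              & \dim (u :&: val y) == k - i.+1]%N) hat f u.
Proof.
rewrite -(sum_grass k (fun u => (\dim (u :&: val x) == k.-1)
                             && (\dim (u :&: val y) == k - i.+1)%N)).
apply: eq_bigl => z; rewrite inE /grass_adj capvC; congr (_ && _).
rewrite di (grass_dist_eq k0 y z) capvC.
have := dimvS (capvSr (val z) (val y)); rewrite dy; lia.
Qed.

(** The covers of w outside x + y are all covers of w without those in x + y; the
hat of the whole space contributes nothing. *)
Lemma sum_outer w : covby w (val x) ->
  \sum_(z | covby w z && ~~ (z <= val x + val y)%VS) hat f z
  = (q ^+ i.+1 * br (n - k - i)%N) *: hat f w - hat f (val x + val y)%VS.
Proof.
move=> wx; have [w_x _] := andP wx; have dw := dim_covby wx; rewrite dx in dw.
have wxy : (w <= val x + val y)%VS by exact: subv_trans (addvSl _ _).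
have := sum_hat_covers f (subvf w).
rewrite (bigID (fun z => (z <= val x + val y)%VS)) /=.
rewrite (eq_bigl (fun z => covby w z && (z <= val x + val y)%VS)); last first.
  by move=> z; rewrite subvf andbT.
rewrite (sum_hat_covers f wxy) (hat_full f0) addr0.
rewrite (eq_bigl (fun z => covby w z && ~~ (z <= val x + val y)%VS)); last first.
  by move=> z; rewrite subvf andbT.
move=> /(canRL (addKr _)) ->; rewrite opprD addrAC -scaleNr -scalerDl; congr (_ *: _ - _).
rewrite (dim_addv_xy dx dy dxy (ltnW i1) ik) dV.
have -> : (n - \dim w = i.+1 + (n - k - i))%N by lia.
have -> : (k + i - \dim w = i.+1)%N by lia.
by rewrite brD; ring.
Qed.

Lemma Bvec_formula : Bvec f x y =
  (q ^+ (2 * i) * br (k - i)%N * br (n - k - i)%N) *: hat f (val x)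
  - (q ^+ (2 * i) * br (n - k - i)%N) *: hat f (val x :&: val y)%VS
  - (q ^+ i * br (k - i)%N) *: hat f (val x + val y)%VS.
Proof.
rewrite Bvec_subspaces (sum_farther f dx dy dxy (ltnW i1) ik).
under eq_bigr => w /andP[wx _] do rewrite (sum_outer wx).
rewrite big_split /= -scaler_sumr sumrN.
have hatw : \sum_(w | covby w (val x) && ~~ (val x :&: val y <= w)%VS) hat f w
   = (q ^+ i.-1 * br (k - i)%N) *: hat f (val x)
     - q ^+ i.-1 *: hat f (val x :&: val y)%VS.
  (* All hyperplanes of x, without those over x :&: y. *)
  have dim0 : (\dim (0%VS : {vspace V}) < \dim (val x))%N by rewrite dimv0 dx.
  have := sum_hat_hyperplanes f (sub0v (val x)) dim0.
  have lt_xy : (\dim (val x :&: val y) < \dim (val x))%N by rewrite dxy dx; lia.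
  rewrite (bigID (fun w => (val x :&: val y <= w)%VS)) /= hat_zero scaler0 addr0.
  rewrite (eq_bigl (fun w => (val x :&: val y <= w)%VS && covby w (val x))); last first.
    by move=> w; rewrite sub0v andbC.
  rewrite (sum_hat_hyperplanes f (capvSl _ _) lt_xy).
  rewrite (eq_bigl (fun w =>
    covby w (val x) && ~~ (val x :&: val y <= w)%VS)); last first.
    by move=> w; rewrite sub0v.
  move=> /(canRL (addKr _)) ->; rewrite opprD addrAC -scaleNr -scalerDl.
  rewrite dimv0 dxy dx; congr (_ *: _ - _ *: _); last by congr (_ ^+ _); lia.
  have -> : ((k - (k - i)).-1 = i.-1)%N by lia.
  have -> : ((k - 0).-1 = i.-1 + (k - i))%N by lia.
  by rewrite brD; ring.
have countw : \sum_(w | covby w (val x) && ~~ (val x :&: val y <= w)%VS)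
     hat f (val x + val y)%VS
   = (q ^+ i * br (k - i)%N) *: hat f (val x + val y)%VS.
  have := card_hyperplanes R (sub0v (val x)).
  rewrite (bigID (fun w => (val x :&: val y <= w)%VS)) /=.
  rewrite (eq_bigl (fun w => (val x :&: val y <= w)%VS && covby w (val x))); last first.
    by move=> w; rewrite sub0v andbC.
  rewrite (card_hyperplanes _ (capvSl _ _)).
  rewrite (eq_bigl (fun w =>
    covby w (val x) && ~~ (val x :&: val y <= w)%VS)); last first.
    by move=> w; rewrite sub0v.
  rewrite dimv0 dxy dx.
  have -> : (k - 0 = (k - (k - i)) + (k - i))%N by lia.
  have -> : (k - (k - i) = i)%N by lia.
  rewrite brD => /addrI <-; rewrite scaler_suml.
  by apply: eq_bigr => w _; rewrite scale1r.
rewrite hatw countw scalerBr !scalerA.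
have -> : (q ^+ (2 * i) = q ^+ i.+1 * q ^+ i.-1) by rewrite -exprD; congr (_ ^+ _); lia.
by congr (_ *: _ - _ *: _ - _); ring.
Qed.

Lemma Bcheck_formula : Bcheck f x y =
  - (q ^+ (2 * i) * br (n - k - i)%N) *: hat f (val x :&: val y)%VS
  - (q ^+ i * br (k - i)%N) *: hat f (val x + val y)%VS.
Proof.
rewrite /Bcheck /Bbar Bvec_formula dV di.
have -> : k%:Z - i%:Z = (k - i)%N by lia.
have -> : n%:Z - k%:Z - i%:Z = (n - k - i)%N by lia.
have -> : 2 * i%:Z = (2 * i)%N by lia.
by rewrite -exprnP addrAC (addrAC (_ *: hat f (val x))) subrr add0r scaleNr.
Qed.

End ClosedForms.

(** * Solving for the meet and the join *)

Theorem theorem13p9 (R : realType) (F : finFieldType) (V : vectType F)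
    (n k : nat) (E : vectType R) (dot : {dot E for idfun})
    (f : grass V 1 -> E) (x y : grass V k) :
  \dim {: V} = n ->
  (2 * k < n)%N -> (6 <= 2 * k)%N ->
  euclidean_rep n dot f ->
  (1 < grass_dist x y < k)%N ->
  let q : R := #|F|%:R in
  let br : int -> R := qbr R #|F| in
  let i : int := grass_dist x y in
  hat f (val x :&: val y)%VS =
    (-1 / (q ^ (k%:Z + i) * br (n%:Z - 2 * k%:Z))) *: Bcheck f x y
    + (- br (k%:Z - i) / (q ^ k%:Z * br (i - 1) * br (n%:Z - 2 * k%:Z)))
      *: Ccheck f x y
  /\
  hat f (val x + val y)%VS =
    (1 / (q ^ k%:Z * br (n%:Z - 2 * k%:Z))) *: Bcheck f x y
    + (br (n%:Z - k%:Z - i)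
       / (q ^ (k%:Z - i) * br (i - 1) * br (n%:Z - 2 * k%:Z)))
      *: Ccheck f x y.
Proof.
move=> dV kn k3 [_ _ _ _ f0]; move di: (grass_dist x y) => j /andP[j1 jk] q br i.
rewrite (Bcheck_formula di j1 jk dV kn f0) (Ccheck_formula f di j1 jk).
have q0 : q != 0 := q_neq0 R F.
have -> : q ^ (k%:Z + i) = q ^+ (k + j) by rewrite exprnP; congr (_ ^ _); lia.
have -> : q ^ k%:Z = q ^+ k by [].
have -> : q ^ (k%:Z - i) = q ^+ (k - j) by rewrite exprnP; congr (_ ^ _); lia.
have -> : n%:Z - 2 * k%:Z = (n - 2 * k)%N by lia.
have -> : k%:Z - i = (k - j)%N by lia.
have -> : n%:Z - k%:Z - i = (n - k - j)%N by lia.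
have -> : i - 1 = j.-1 by lia.
rewrite -[qbr R #|F|]/br.
have E1 : br (n - k - j)%N = br (k - j)%N + q ^+ (k - j) * br (n - 2 * k)%N.
  by rewrite -brD; congr qbr; lia.
have E2 : q ^+ k = q ^+ (k - j) * q ^+ j by rewrite -exprD subnK // ltnW.
have E3 : q ^+ (2 * j) = q ^+ j * q ^+ j by rewrite -exprD addnn mul2n.
have b1 : br (n - 2 * k)%N != 0 by apply: br_neq0; lia.
have b2 : br j.-1 != 0 by apply: br_neq0; lia.
have p1 : q ^+ (k - j) != 0 by rewrite expf_neq0.
have p2 : q ^+ j != 0 by rewrite expf_neq0.
(* Every power of q and bracket is now an expression in b = [n - 2k],
   c = [j - 1], d = [k - j], r = q^(k - j) and s = q^j. *)
rewrite exprD E1 E2 E3 !scalerDr !scalerN !scalerA.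
move: b1 b2 p1 p2.
move: (br (n - 2 * k)%N) (br j.-1) (br (k - j)%N) (q ^+ (k - j)) (q ^+ j).
move=> b c d r s b0 c0 r0 s0.
set X := hat f _; set Y := hat f _.
rewrite -!scaleNr; split; rewrite addrACA -!scalerDl.
  rewrite -[LHS]scale1r -[LHS]addr0 -(scale0r Y).
  by congr (_ *: _ + _ *: _); field; rewrite b0 c0 r0 s0.
rewrite -[LHS]scale1r -[LHS]add0r -(scale0r X).
by congr (_ *: _ + _ *: _); field; rewrite b0 c0 r0 ?s0.
Qed.
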